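(* Let $\mathcal{B}$ be a swap structure for $\mathbf{Ciore}$. Then there exist a set $I$ and a monomorphism of algebras $\hat h:\mathcal{B}\to\prod_{i\in I}\mathcal{B}_{\mathbb{A}_2}^{\mathbf{Ciore}}$.
   Context: Let $\Sigma=\{\wedge,\vee,\to,\neg,\circ\}$, with $\wedge,\vee,\to$ binary and $\neg,\circ$ unary. For a Boolean algebra $\mathcal{A}$ with domain $A$ (the one-element Boolean algebra is allowed), with complement $\sim$, put $\mathrm{B}_{\mathcal{A}}^{\mathbf{ciw}}=\{(z_1,z_2)\in A^2 : z_1\vee z_2=1\}$. A swap structure for $\mathbf{Ciore}$ over $\mathcal{A}$ is a multialgebra over $\Sigma$ (a set with operations whose values are nonempty subsets) with domain $B\subseteq\mathrm{B}_{\mathcal{A}}^{\mathbf{ciw}}$, such that $0\in\{z_1:(z_1,z_2)\in B\}$, whose multioperations are single-valued and given, for all $(z_1,z_2),(w_1,w_2)\in B$, by - $(z_1,z_2)\#(w_1,w_2)=\{(z_1\# w_1,\ (z_1\# w_1)\to((z_1\wedge z_2)\wedge(w_1\wedge w_2)))\}$ for each $\#\in\{\wedge,\vee,\to\}$; - $\neg(z_1,z_2)=\{(z_2,z_1)\}$; - $\circ(z_1,z_2)=\{({\sim}(z_1\wedge z_2),\ z_1\wedge z_2)\}$. Being single-valued, such structures are regarded as ordinary algebras over $\Sigma$ (identifying a singleton with its element); monomorphisms of algebras are injective homomorphisms, and products are direct products. A swap structure for $\mathbf{Ciore}$ is one over some Boolean algebra $\mathcal{A}$, and $\mathcal{B}_{\mathcal{A}}^{\mathbf{Ciore}}$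 denotes the one with full domain $\mathrm{B}_{\mathcal{A}}^{\mathbf{ciw}}$. $\mathbb{A}_2$ is the two-element Boolean algebra (so $\mathcal{B}_{\mathbb{A}_2}^{\mathbf{Ciore}}$ has the three elements $(1,0),(1,1),(0,1)$). *)

(* Defs.v *)
From HB Require Import structures.
From mathcomp Require Import all_boot all_order.
From mathcomp Require Import boolp classical_sets.
Set Implicit Arguments.
Unset Strict Implicit.
Unset Printing Implicit Defensive.

Import Order.Theory.
Local Open Scope classical_set_scope.

Variant binop := And | Or | Imp.
Variant unop := Neg | Circ.

Record multialg (T : Type) := MultiAlg {
  mbin : binop -> T -> T -> set T;
  mun : unop -> T -> set T;
  mbin_neq0 : forall o x y, mbin o x y !=set0;
  mun_neq0 : forall o x, mun o x !=set0
}.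

Record algebra := Algebra {
  acar :> Type;
  abin : binop -> acar -> acar -> acar;
  aun : unop -> acar -> acar
}.

Definition homomorphism (A B : algebra) (h : A -> B) : Prop :=
  (forall o x y, h (abin o x y) = abin o (h x) (h y)) /\
  (forall o x, h (aun o x) = aun o (h x)).

Definition monomorphism (A B : algebra) (h : A -> B) : Prop :=
  homomorphism h /\ injective h.

Definition prod_algebra (I : Type) (F : I -> algebra) : algebra :=
  {| acar := forall i, F i;
     abin := fun o x y i => abin o (x i) (y i);
     aun := fun o x i => aun o (x i) |}.

Definition is_singleton (T : Type) (S : set T) : Prop :=
  exists x, S = [set x].

Definition the_element (T : Type) (S : set T) (S1 : is_singleton S) : T :=
  projT1 (cid S1).

Definition single_valued (T : Type) (M : multialg T) : Prop :=
  (forall o x y, is_singleton (mbin M o x y)) /\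
  (forall o x, is_singleton (mun M o x)).

Definition algebra_of_multialg (T : Type) (M : multialg T)
    (M1 : single_valued M) : algebra :=
  {| acar := T;
     abin := fun o x y => the_element (M1.1 o x y);
     aun := fun o x => the_element (M1.2 o x) |}.

(* Boolean algebras are the structures [ctbDistrLatticeType d]; nothing there
   forces \bot and \top to differ, so the one-element algebra is included. *)
Section Swap.
Context {d : Order.disp_t} {A : ctbDistrLatticeType d}.

Definition bimp (a b : A) : A := (~` a `|` b)%O.

Definition bop (o : binop) (a b : A) : A :=
  match o with
  | And => (a `&` b)%O
  | Or => (a `|` b)%O
  | Imp => bimp a b
  end.

Definition ciore_bin (o : binop) (z w : A * A) : A * A :=
  (bop o z.1 w.1,
   bimp (bop o z.1 w.1) ((z.1 `&` z.2) `&` (w.1 `&` w.2))%O).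

Definition ciore_un (o : unop) (z : A * A) : A * A :=
  match o with
  | Neg => (z.2, z.1)
  | Circ => ((~` (z.1 `&` z.2))%O, (z.1 `&` z.2)%O)
  end.

End Swap.

Definition Bciw {d : Order.disp_t} (A : ctbDistrLatticeType d) : set (A * A) :=
  [set z : A * A | (z.1 `|` z.2)%O = \top%O].
Arguments Bciw {d} A _.

(* The domain B is viewed as the type [set_type B]; the prescribed values of the
   multioperations are compared, as sets, inside A * A. *)
Record swap_Ciore {d : Order.disp_t} (A : ctbDistrLatticeType d) := SwapCiore {
  swap_dom : set (A * A);
  swap_sub : swap_dom `<=` Bciw A;
  swap_dom0 : [set z.1 | z in swap_dom] \bot%O;
  swap_malg : multialg (set_type swap_dom);
  swap_binE : forall o (z w : set_type swap_dom),
    val @` mbin swap_malg o z w = [set ciore_bin o (val z) (val w)];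
  swap_unE : forall o (z : set_type swap_dom),
    val @` mun swap_malg o z = [set ciore_un o (val z)]
}.

Section SwapTheory.
Context {d : Order.disp_t} {A : ctbDistrLatticeType d}.

Lemma is_singleton_val (P : set (A * A)) (S : set (set_type P)) (z : A * A) :
  val @` S = [set z] -> is_singleton S.
Proof.
move=> SE; have [x Sx xz] : (val @` S) z by rewrite SE.
exists x; apply/seteqP; split=> y /=; last by move->.
move=> Sy; apply: val_inj; rewrite xz.
by have : (val @` S) (val y) by [exists y]; rewrite SE.
Qed.

Lemma swap_single_valued (B : swap_Ciore A) : single_valued (swap_malg B).
Proof.
by split=> [o x y|o x]; apply: is_singleton_val; [exact: swap_binE|exact: swap_unE].
Qed.

Definition swap_algebra (B : swap_Ciore A) : algebra :=
  algebra_of_multialg (swap_single_valued B).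

Lemma ciore_bin_closed o (z w : A * A) :
  Bciw A z -> Bciw A w -> Bciw A (ciore_bin o z w).
Proof.
by move=> _ _; rewrite /Bciw /= /bimp joinA joinxC join1x.
Qed.

Lemma ciore_un_closed o (z : A * A) : Bciw A z -> Bciw A (ciore_un o z).
Proof. by rewrite /Bciw; case: o => /= zT; [rewrite joinC|rewrite joinC joinxC]. Qed.

End SwapTheory.

Section Full.
Context {d : Order.disp_t} (A : ctbDistrLatticeType d).

Definition full_bin o (z w : set_type (Bciw A)) : set (set_type (Bciw A)) :=
  [set t | val t = ciore_bin o (val z) (val w)].

Definition full_un o (z : set_type (Bciw A)) : set (set_type (Bciw A)) :=
  [set t | val t = ciore_un o (val z)].

Lemma full_bin_neq0 o z w : full_bin o z w !=set0.
Proof.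
have zwB := ciore_bin_closed o (set_mem (valP z)) (set_mem (valP w)).
by exists (exist (fun t => t \in Bciw A) _ (mem_set zwB)).
Qed.

Lemma full_un_neq0 o z : full_un o z !=set0.
Proof.
have zB := ciore_un_closed o (set_mem (valP z)).
by exists (exist (fun t => t \in Bciw A) _ (mem_set zB)).
Qed.

Definition full_multialg : multialg (set_type (Bciw A)) :=
  MultiAlg full_bin_neq0 full_un_neq0.

Lemma full_dom0 : [set z.1 | z in Bciw A] \bot%O.
Proof. by exists (\bot%O, \top%O) => //; rewrite /Bciw /= joinx1. Qed.

Lemma full_binE o z w :
  val @` mbin full_multialg o z w = [set ciore_bin o (val z) (val w)].
Proof.
apply/seteqP; split=> [_ [t tE <-]//|_ ->].
by have [t tE] := full_bin_neq0 o z w; exists t.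
Qed.

Lemma full_unE o z :
  val @` mun full_multialg o z = [set ciore_un o (val z)].
Proof.
apply/seteqP; split=> [_ [t tE <-]//|_ ->].
by have [t tE] := full_un_neq0 o z; exists t.
Qed.

Definition full_Ciore : swap_Ciore A :=
  {| swap_dom := Bciw A;
     swap_sub := @subset_refl _ (Bciw A);
     swap_dom0 := full_dom0;
     swap_malg := full_multialg;
     swap_binE := full_binE;
     swap_unE := full_unE |}.

End Full.

Definition A2 : ctbDistrLatticeType Order.BoolOrder.bool_display := bool.

(* Main.v *)
Require Import Defs.
From mathcomp Require Import all_boot all_order.
From mathcomp Require Import boolp classical_sets.
Set Implicit Arguments.
Unset Strict Implicit.
Unset Printing Implicit Defensive.

(** Boolean homomorphisms [A -> bool] separate the points of [A] (ultrafilter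
    theorem). Every operation of a swap structure is a pair of Boolean terms in
    the coordinates, so each such homomorphism, applied to both coordinates,
    is a homomorphism into the three-element structure, and together they
    embed the swap structure in a power of it. *)

Import Order.Theory.
Local Open Scope classical_set_scope.

Section BooleanHomomorphisms.
Context {d d' : Order.disp_t} {A : ctbDistrLatticeType d}.
Context {A' : ctbDistrLatticeType d'}.
Implicit Type f : A -> A'.

(** Meet and complement suffice: join, top and implication are Boolean terms in them, so their
    preservation is derived. *)
Definition bool_hom f : Prop :=
  {morph f : x y / (x `&` y)%O} /\ {morph f : x / (~` x)%O}.

Lemma bool_hom_join f : bool_hom f -> {morph f : x y / (x `|` y)%O}.
Proof. by move=> [fI fC] x y; rewrite -[LHS]complK -fC complU fI !fC -complU complK. Qed.

Lemma bool_hom_top f : bool_hom f -> f \top%O = \top%O.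
Proof. by move=> fH; rewrite -(joinxC \top%O) (bool_hom_join fH) fH.2 joinxC. Qed.

Lemma bool_hom_bop f o x y : bool_hom f -> f (bop o x y) = bop o (f x) (f y).
Proof.
by move=> fH; case: o; rewrite /= /bimp ?fH.1 ?(bool_hom_join fH) ?fH.2.
Qed.

Definition map_pair f (z : A * A) : A' * A' := (f z.1, f z.2).

Lemma map_pair_ciore_bin f o z w : bool_hom f ->
  map_pair f (ciore_bin o z w) = ciore_bin o (map_pair f z) (map_pair f w).
Proof.
move=> fH; congr pair; first exact: bool_hom_bop.
by rewrite (bool_hom_bop Imp _ _ fH) bool_hom_bop// !fH.1.
Qed.

Lemma map_pair_ciore_un f o z : bool_hom f ->
  map_pair f (ciore_un o z) = ciore_un o (map_pair f z).
Proof. by move=> fH; case: o; rewrite /map_pair //= !(fH.1, fH.2). Qed.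

Lemma map_pair_Bciw f z : bool_hom f -> Bciw A z -> Bciw A' (map_pair f z).
Proof.
by move=> fH; rewrite /Bciw /= -(bool_hom_join fH) => ->; exact: bool_hom_top.
Qed.

End BooleanHomomorphisms.

Section Separation.
Context {d : Order.disp_t} {A : ctbDistrLatticeType d}.
Implicit Types (c x y : A) (F : set A).

(* A possibly empty filter, none of whose members is disjoint from [c];
   admitting [set0] makes Zorn's lemma applicable to the empty chain. *)
Definition prefilter_meeting c F : Prop :=
  [/\ forall x y, F x -> (x <= y)%O -> F y,
      forall x y, F x -> F y -> F (x `&` y)%O
    & forall x, F x -> (x `&` c)%O <> \bot%O].

Lemma prefilter_meeting_bigcup c (C : set (set A)) :
  C `<=` prefilter_meeting c -> total_on C subset ->
  prefilter_meeting c (\bigcup_(F in C) F).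
Proof.
move=> CP Ctot; split.
- by move=> x y [F CF Fx] xy; exists F => //; have [up _ _] := CP F CF; exact: up xy.
- move=> x y [F CF Fx] [G CG Gy].
  have [FG|GF] := Ctot F G CF CG.
  + by exists G => //; have [_ I _] := CP G CG; apply: I => //; exact: FG.
  + by exists F => //; have [_ I _] := CP F CF; apply: I => //; exact: GF.
- by move=> x [F CF Fx]; have [_ _ N] := CP F CF; exact: N.
Qed.

(** Otherwise adjoining [y] to [F] would generate a strictly larger prefilter meeting [c]. *)
Lemma maximal_prefilter_notin c F y : prefilter_meeting c F ->
  (forall G, F `<` G -> ~ prefilter_meeting c G) -> ~ F y ->
  exists2 m, F m \/ m = \top%O & (m `&` y `&` c)%O = \bot%O.
Proof.
move=> [up I _] maxF nFy; apply: contrapT => nex.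
(* The filter generated by [F] and [y]; allowing [m] to be top puts [y] in it even when [F] is
   empty. *)
pose G := [set z | exists2 m, F m \/ m = \top%O & (m `&` y <= z)%O].
apply: (maxF G).
  split; last by apply/existsNP; exists y => yG; apply/nFy/yG; exists \top%O; [right|rewrite meet1x].
  by move=> z Fz; exists z; [left|exact: leIl].
split.
- by move=> z w [m Fm mz] zw; exists m => //; exact: le_trans zw.
- move=> z w [m Fm mz] [n Fn nw]; exists (m `&` n)%O.
    case: Fm Fn => [Fm|->] [Fn|->]; rewrite ?meetx1 ?meet1x; [|by left..|by right].
    by left; exact: I.
  by rewrite lexI (le_trans _ mz) ?(le_trans _ nw)// leI2// ?leIl ?leIr.
- move=> z [m Fm mz] zc; apply: nex; exists m => //.
  by apply/eqP; rewrite -lex0 -zc leI2.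
Qed.

(** A maximal prefilter meeting [c], obtained from Zorn's lemma, is an ultrafilter containing [c],
    and [f] is its indicator function. *)
Lemma exists_bool_hom c : c <> \bot%O -> exists2 f : A -> A2, bool_hom f & f c.
Proof.
move=> c0.
have [F [PF maxF]] := Zorn_bigcup (@prefilter_meeting_bigcup c).
have notin := maximal_prefilter_notin PF maxF.
have [up I N] := PF.
(* Nonemptiness of [F] is where [c] being nonzero is used; it then absorbs the case of [m] being top
   in [notin]. *)
have FT : F \top%O.
  apply: contrapT => /notin[m Fm]; rewrite meetx1.
  by case: Fm => [/N//|->]; rewrite meet1x.
have {}notin y : ~ F y -> exists2 m, F m & (m `&` y `&` c)%O = \bot%O.
  by move=> /notin[m [|->] my]; [exists m|exists \top%O].
have Fc : F c by apply: contrapT => /notin[m Fm]; rewrite -meetA meetxx; exact: N.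
have FC y : F (~` y)%O <-> ~ F y.
  split=> [Fny Fy|nFy]; first by apply: (N _ (I _ _ Fy Fny)); rewrite meetxC meet0x.
  apply: contrapT => nFny.
  have [m Fm my] := notin _ nFy; have [n Fn ny] := notin _ nFny.
  apply: (N _ (I _ _ Fm Fn)); apply/eqP.
  (* Split the meet of [m], [n] and [c] along [y] and its complement: each piece lies below one of
     the two zero meets [my] and [ny]. *)
  rewrite -lex0 -[leLHS]meetx1 -(joinxC y) meetUr leUx -[in X in X && _]my -ny.
  by rewrite [X in (X <= _)%O && _]meetAC [X in _ && (X <= _)%O]meetAC !leI2 ?leIl ?leIr.
exists (fun x => `[<F x>]); last exact/asboolP.
split=> [x y|x].
- apply/asboolP/andP => [Fxy|[/asboolP Fx /asboolP Fy]]; last exact: I.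
  by split; apply/asboolP; apply: up Fxy _; rewrite ?leIl ?leIr.
- by rewrite (propext (FC x)) asbool_neg.
Qed.

(** If [a] is not below [b], then the meet of [a] with the complement of [b] is nonzero, so some [f]
    sends it to true; this is impossible when [f a = f b]. *)
Lemma bool_hom_separates x y :
  (forall f : A -> A2, bool_hom f -> f x = f y) -> x = y.
Proof.
have le_sep a b : (forall f : A -> A2, bool_hom f -> f a = f b) -> (a <= b)%O.
  move=> fab; apply: contrapT => /negP nab.
  have [|f fH] := @exists_bool_hom (a `&` ~` b)%O.
    by move=> /eqP; rewrite -diffE diff_eq0 (negbTE nab).
  by rewrite fH.1 fH.2 fab// meetxC.
by move=> fxy; apply/le_anti; rewrite !le_sep// => f /fxy.
Qed.

End Separation.

Section SwapAlgebra.
Context {d : Order.disp_t} {A : ctbDistrLatticeType d} (B : swap_Ciore A).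

Lemma the_elementP (T : Type) (S : set T) (S1 : is_singleton S) :
  S (the_element S1).
Proof. by rewrite {1}(projT2 (cid S1)). Qed.

(** The chosen element belongs to the value of the multioperation, whose image under [val] is the
    prescribed singleton. *)
Lemma val_swap_bin o (x y : swap_algebra B) :
  val (abin o x y : set_type (swap_dom B)) = ciore_bin o (val x) (val y).
Proof.
have : (val @` mbin (swap_malg B) o x y) (val (abin o x y : set_type (swap_dom B))).
  by exists (abin o x y) => //; exact: the_elementP.
by rewrite swap_binE.
Qed.

Lemma val_swap_un o (x : swap_algebra B) :
  val (aun o x : set_type (swap_dom B)) = ciore_un o (val x).
Proof.
have : (val @` mun (swap_malg B) o x) (val (aun o x : set_type (swap_dom B))).
  by exists (aun o x) => //; exact: the_elementP.
by rewrite swap_unE.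
Qed.

Lemma val_swap_Bciw (x : swap_algebra B) :
  Bciw A (val (x : set_type (swap_dom B))).
Proof. exact/swap_sub/set_mem/(valP x). Qed.

Definition swap_map {d'} {A' : ctbDistrLatticeType d'} (f : A -> A')
    (fH : bool_hom f) (x : swap_algebra B) : swap_algebra (full_Ciore A') :=
  exist (fun t => t \in Bciw A') _ (mem_set (map_pair_Bciw fH (val_swap_Bciw x))).

End SwapAlgebra.

Lemma swap_map_homomorphism {d d'} {A : ctbDistrLatticeType d}
    {A' : ctbDistrLatticeType d'} (B : swap_Ciore A) (f : A -> A')
    (fH : bool_hom f) :
  homomorphism (@swap_map _ _ B _ _ f fH).
Proof.
split=> [o x y|o x]; apply: (@val_inj _ _ (set_type (Bciw A'))).
- by rewrite (@val_swap_bin _ _ (full_Ciore A')) /= val_swap_bin map_pair_ciore_bin.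
- by rewrite (@val_swap_un _ _ (full_Ciore A')) /= val_swap_un map_pair_ciore_un.
Qed.

Theorem theorem9p24 (d : Order.disp_t) (A : ctbDistrLatticeType d)
    (B : swap_Ciore A) :
  exists (I : Type)
    (h : swap_algebra B -> prod_algebra (fun _ : I => swap_algebra (full_Ciore A2))),
    monomorphism h.
Proof.
(* Over the one-element Boolean algebra there is no such [f]: the index type is empty and the
   product has one point. *)
exists {f : A -> A2 | bool_hom f}, (fun x f => swap_map (projT2 f) x).
split; first split=> [o x y|o x].
- by apply: functional_extensionality_dep => f; exact: (swap_map_homomorphism B _).1.
- by apply: functional_extensionality_dep => f; exact: (swap_map_homomorphism B _).2.
move=> x y hxy; apply: (@val_inj _ _ (set_type (swap_dom B))).
(* Compare the components at index [f]; separation is then applied to each coordinate. *)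
have eqf (f : A -> A2) (fH : bool_hom f) : map_pair f (val x) = map_pair f (val y).
  exact: (congr1 (fun g => val (g (exist _ f fH) : set_type (Bciw A2))) hxy).
rewrite [LHS]surjective_pairing [RHS]surjective_pairing.
by congr pair; apply: bool_hom_separates => f /eqf[].
Qed.
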